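(* Let $\mathsf{FOL\Box}$ be the system defined in the context. For every formula $A$ of $\mathcal{L}(\forall,\Box)$: if $A\in \mathsf{FOL\Box}$, then $A$ is logically valid, i.e. $\mathcal{A}\models A$ for every universal structure $\mathcal{A}$.
   Context: Language $\mathcal{L}(\forall,\Box)$: first-order language with identity $=$, a set of predicate symbols $P^n_j$ ($n$-ary), variables, no constants or function symbols, connectives $\neg,\to$, quantifier $\forall$, and a modal operator $\Box$ (read ''is a thesis''), allowing arbitrary nesting. Other connectives are defined as usual, $\exists x := \neg\forall x\neg$, and $\Diamond := \neg\Box\neg$. A formula is $\Box$-free if it contains no $\Box$. $\mathsf{FOL}$ denotes the set of $\Box$-free formulas that are theses (equivalently, valid formulas) of classical first-order logic with identity. Semantics: a structure is $\mathcal{A}=\langle \mathcal{W},\{\mathcal{D}_w\}_{w\in\mathcal{W}}, I\rangle$ with $\mathcal{W}\neq\emptyset$ (worlds), nonempty domains $\mathcal{D}_w$, and $I(P^n_j,w)\subseteq \mathcal{D}_w^n$. A valuation is a function $v$ with $v(x,w)\in\mathcal{D}_w$ for every variable $x$ and world $w$; $v^a_x(w)$ denotes the valuation agreeing with $v$ everywhere except that it sends $x$ at world $w$ to $a\in\mathcal{D}_w$. Satisfaction: $\mathcal{A},v,w\models P^n_j(x_1,\dots,x_n)$ iff $\langle v(x_1,w),\dots,v(x_n,w)\rangle\in I(P^n_j,w)$; $\mathcal{A},v,w\models x=y$ iff $v(x,w)=v(y,w)$; $\neg,\to$ classical; $\mathcal{A},v,w\models\forall xA$ iff $\mathcal{A},v^a_x(w),w\models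 A$ for every $a\in\mathcal{D}_w$; $\mathcal{A},v,w\models\Box A$ iff $\mathcal{A},v',w'\models A$ for every valuation $v'$ on $\mathcal{A}$ and every $w'\in\mathcal{W}$. $\mathcal{A}\models A$ means $\mathcal{A},v,w\models A$ for all $v,w$. Let $\mathfrak{C}$ be the class of all such structures. A structure $\mathcal{A}\in\mathfrak{C}$ is universal if for every $\Box$-free formula $A$: $\mathcal{A}\models A$ implies $\mathcal{B}\models A$ for every $\mathcal{B}\in\mathfrak{C}$. $A$ is logically valid iff $\mathcal{A}\models A$ for every universal structure $\mathcal{A}$. Free variables and substitution: an occurrence of $x$ in $A$ is $\forall\Box$-bound if it is in the scope of a quantifier on $x$ or inside the scope of some $\Box$; otherwise it is $\forall\Box$-free. $x$ is a $\forall\Box$-free variable of $A$ if it has a $\forall\Box$-free occurrence. $A(^y/_x)$ (the $\forall\Box$-free substitution) is the simultaneous replacement of every $\forall\Box$-free occurrence of $x$ by $y$, provided $y$ is not captured by a quantifier at any replaced position. The system $\mathsf{FOL\Box}$ is the smallest set of formulas containing all instances of classical propositional tautologies and all instances of: (K) $\Box(A\to B)\to(\Box A\to\Box B)$; (T) $\Box A\to A$; (5) $\neg\Box A\to\Box\neg\Box A$; ($\forall1$) $\forall xA\to A(^y/_x)$ for an admissible $\forall\Box$-free substitution; ($\forall2$) $\forall x(A\to B)\to(A\to\forall xB)$ if $x$ is not a $\forall\Box$-free variable of $A$; (ID) $x=x$; (=) $x=y\wedge A(x)\to A(y)$ for $\Box$-free $A$ (the usual first-order identity axiom, replacing free occurrences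 of $x$ by $y$); (mix) $\Box A\to\forall xA$; (!) $\neg\Box A$ for every $\Box$-free formula $A\notin\mathsf{FOL}$; and closed under (RG) if $A\in\mathsf{FOL\Box}$ then $\Box A\in\mathsf{FOL\Box}$, and (MP) if $A\to B, A\in\mathsf{FOL\Box}$ then $B\in\mathsf{FOL\Box}$. *)

(* Defs.v *)
From mathcomp Require Import all_boot.
From mathcomp Require Import boolp.

Set Implicit Arguments.
Unset Strict Implicit.
Unset Printing Implicit Defensive.

Record signature : Type := Signature {
  pred_sym : Type;
  arity : pred_sym -> nat
}.

Notation var := nat (only parsing).

Inductive formula (S : signature) : Type :=
| Atom (P : pred_sym S) (xs : (arity P).-tuple var)
| Equal (x y : var)
| Neg (A : formula S)
| Imp (A B : formula S)
| All (x : var) (A : formula S)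
| Box (A : formula S).

Arguments Atom {S} P xs.
Arguments Equal {S} x y.

Definition And (S : signature) (A B : formula S) : formula S :=
  Neg (Imp A (Neg B)).

Fixpoint box_free (S : signature) (A : formula S) : bool :=
  match A with
  | Atom _ _ | Equal _ _ => true
  | Neg B => box_free B
  | Imp B C => box_free B && box_free C
  | All _ B => box_free B
  | Box _ => false
  end.

(* [abfree x A]: x has an occurrence in A that lies neither in the scope of a
   quantifier on x nor in the scope of a box. *)
Fixpoint abfree (S : signature) (x : var) (A : formula S) : bool :=
  match A with
  | Atom _ xs => x \in tval xs
  | Equal y z => (x == y) || (x == z)
  | Neg B => abfree x B
  | Imp B C => abfree x B || abfree x C
  | All y B => (y != x) && abfree x B
  | Box _ => false
  end.

Definition rename (x y z : var) : var := if z == x then y else z.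

Fixpoint subst (S : signature) (x y : var) (A : formula S) : formula S :=
  match A with
  | Atom P xs => Atom P (map_tuple (rename x y) xs)
  | Equal z t => Equal (rename x y z) (rename x y t)
  | Neg B => Neg (subst x y B)
  | Imp B C => Imp (subst x y B) (subst x y C)
  | All z B => if z == x then All z B else All z (subst x y B)
  | Box B => Box B
  end.

(* [admissible x y A]: no occurrence of x replaced in [subst x y A] is in the
   scope of a quantifier on y. *)
Fixpoint admissible (S : signature) (x y : var) (A : formula S) : bool :=
  match A with
  | Atom _ _ | Equal _ _ => true
  | Neg B => admissible x y B
  | Imp B C => admissible x y B && admissible x y C
  | All z B =>
      (z == x) || (((z == y) ==> ~~ abfree x B) && admissible x y B)
  | Box _ => true
  end.

Record structure (S : signature) : Type := Structure {
  world : Type;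
  world_inhabited : inhabited world;
  dom : world -> Type;
  dom_inhabited : forall w, inhabited (dom w);
  interp : forall (P : pred_sym S) (w : world), (arity P).-tuple (dom w) -> Prop
}.

Definition valuation (S : signature) (M : structure S) : Type :=
  var -> forall w : world M, dom w.

Definition update (S : signature) (M : structure S) (v : valuation M)
    (x : var) (w : world M) (a : dom w) : valuation M :=
  fun y u =>
    if y == x then
      match pselect (w = u) with
      | left e => eq_rect w (@dom S M) a u e
      | right _ => v y u
      end
    else v y u.

Fixpoint sat (S : signature) (M : structure S) (v : valuation M) (w : world M)
    (A : formula S) : Prop :=
  match A with
  | Atom P xs => interp (map_tuple (fun x => v x w) xs)
  | Equal x y => v x w = v y w
  | Neg B => ~ sat v w B
  | Imp B C => sat v w B -> sat v w C
  | All x B => forall a : dom w, sat (update v x a) w B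
  | Box B => forall (v' : valuation M) (w' : world M), sat v' w' B
  end.

Definition true_in (S : signature) (M : structure S) (A : formula S) : Prop :=
  forall (v : valuation M) (w : world M), sat v w A.

Definition universal (S : signature) (M : structure S) : Prop :=
  forall A : formula S, box_free A -> true_in M A ->
    forall N : structure S, true_in N A.

Definition logically_valid (S : signature) (A : formula S) : Prop :=
  forall M : structure S, universal M -> true_in M A.

Record fo_model (S : signature) : Type := FoModel {
  carrier : Type;
  carrier_inhabited : inhabited carrier;
  fo_interp : forall P : pred_sym S, (arity P).-tuple carrier -> Prop
}.

(* Tarskian satisfaction; only meaningful on box-free formulas, the value on
   [Box _] being arbitrary. *)
Fixpoint fo_sat (S : signature) (M : fo_model S) (r : var -> carrier M)
    (A : formula S) : Prop :=
  match A with
  | Atom P xs => fo_interp (map_tuple r xs)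
  | Equal x y => r x = r y
  | Neg B => ~ fo_sat r B
  | Imp B C => fo_sat r B -> fo_sat r C
  | All x B => forall a : carrier M, fo_sat (fun y => if y == x then a else r y) B
  | Box _ => False
  end.

(* The theses of classical first-order logic with identity, given as its valid
   formulas. *)
Definition FOL (S : signature) (A : formula S) : Prop :=
  box_free A /\ forall (M : fo_model S) (r : var -> carrier M), fo_sat r A.

Inductive pform : Type :=
| PVar (n : nat)
| PNeg (p : pform)
| PImp (p q : pform).

Fixpoint peval (e : nat -> bool) (p : pform) : bool :=
  match p with
  | PVar n => e n
  | PNeg q => ~~ peval e q
  | PImp q r => peval e q ==> peval e r
  end.

Definition tautology (p : pform) : Prop := forall e : nat -> bool, peval e p.

Fixpoint pinst (S : signature) (s : nat -> formula S) (p : pform) : formula S :=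
  match p with
  | PVar n => s n
  | PNeg q => Neg (pinst s q)
  | PImp q r => Imp (pinst s q) (pinst s r)
  end.

Inductive FOLbox (S : signature) : formula S -> Prop :=
| ax_taut (p : pform) (s : nat -> formula S) :
    tautology p -> FOLbox (pinst s p)
| ax_K (A B : formula S) :
    FOLbox (Imp (Box (Imp A B)) (Imp (Box A) (Box B)))
| ax_T (A : formula S) :
    FOLbox (Imp (Box A) A)
| ax_5 (A : formula S) :
    FOLbox (Imp (Neg (Box A)) (Box (Neg (Box A))))
| ax_all1 (x y : var) (A : formula S) :
    admissible x y A -> FOLbox (Imp (All x A) (subst x y A))
| ax_all2 (x : var) (A B : formula S) :
    ~~ abfree x A -> FOLbox (Imp (All x (Imp A B)) (Imp A (All x B)))
| ax_id (x : var) :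
    FOLbox (Equal x x)
| ax_eq (x y : var) (A : formula S) :
    box_free A -> admissible x y A ->
    FOLbox (Imp (And (Equal x y) A) (subst x y A))
| ax_mix (x : var) (A : formula S) :
    FOLbox (Imp (Box A) (All x A))
| ax_bang (A : formula S) :
    box_free A -> ~ FOL A -> FOLbox (Neg (Box A))
| rule_RG (A : formula S) :
    FOLbox A -> FOLbox (Box A)
| rule_MP (A B : formula S) :
    FOLbox (Imp A B) -> FOLbox A -> FOLbox B.

(* Main.v *)
Require Import Defs.
From mathcomp Require Import all_boot.
From mathcomp Require Import boolp.

(** Satisfaction at a world [w] depends only on the values at [w] of the
    variables free outside boxes, since a box discards the valuation.  This
    makes the quantifier and identity axioms sound in every structure, with the
    classical arguments.  Only the axiom [~ Box A], for [A] not in [FOL], uses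
    universality: a first-order countermodel of [A] is a one-world structure in
    which [A] is not true. *)

Section Satisfaction.

Context {S : signature} {M : structure S}.
Implicit Types (v : valuation M) (w : world M) (A : formula S).

Lemma update_at v x w (a : dom w) y :
  update v x a y w = if y == x then a else v y w.
Proof.
rewrite /update; case: eqP => // _; case: pselect => // e.
(* The transport inside [update] runs along a proof of [w = w]; proof irrelevance makes it
   trivial. *)
by rewrite (Prop_irrelevance e (erefl w)).
Qed.

Lemma sat_ext v v' w A :
    (forall x, abfree x A -> v x w = v' x w) ->
  sat v w A <-> sat v' w A.
Proof.
elim: A v v' => /= [P xs|x y|B IH|B IHB C IHC|x B IH|B _] v v' Hv //.
- suff -> : map_tuple (fun x => v x w) xs = map_tuple (fun x => v' x w) xs by [].
  by apply: val_inj; apply/eq_in_map => x; apply: Hv.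
- by rewrite !Hv ?eqxx ?orbT.
- by rewrite (IH v v').
- rewrite (IHB v v') ?(IHC v v') // => x Hx; apply: Hv; rewrite Hx ?orbT //.
- have E (a : dom w) : sat (update v x a) w B <-> sat (update v' x a) w B.
    apply: IH => y Hy; rewrite !update_at; case: eqP => // /eqP nyx.
    by apply: Hv; rewrite eq_sym nyx.
  by split=> H a; apply/E.
Qed.

Lemma sat_subst v w x y A : admissible x y A ->
  sat v w (subst x y A) <-> sat (update v x (v y w)) w A.
Proof.
have rn u z : u (rename x y z) w = update u x (u y w) z w.
  by rewrite update_at /rename; case: eqP.
elim: A v => /= [P xs|z t|B IH|B IHB C IHC|z B IH|B _] v //.
- move=> _; set t1 := map_tuple _ _; set t2 := map_tuple _ _.
  suff -> : t1 = t2 by [].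
  by apply: val_inj; rewrite /= -map_comp; apply: eq_map => z /=; apply: rn.
- by rewrite !rn.
- by move=> adm; rewrite IH.
- by case/andP=> admB admC; rewrite IHB ?IHC.
- have [-> _|nzx /= /andP[cap adm]] := eqVneq z x.
    apply: sat_ext => t /= /andP[nxt _].
    by rewrite update_at eq_sym (negPf nxt).
  have E (a : dom w) : sat (update v z a) w (subst x y B) <->
             sat (update (update v x (v y w)) z a) w B.
    (* The updates at [x] and [z] come in opposite orders. They can disagree only at [x] when
       [y = z], and then admissibility says that [x] is not free in [B]. *)
    rewrite IH //; apply: sat_ext => t Ht; rewrite !update_at.
    have [etx|//] := eqVneq t x; subst t; rewrite [x == z]eq_sym (negPf nzx).
    by have [eyz|//] := eqVneq y z; move: cap; rewrite eyz eqxx Ht.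
  by split=> H a; apply/E.
Qed.

(** Classically, truth of the instances at [v] and [w] is a boolean assignment, to which a tautology
    applies. *)
Lemma sat_pinst v w (s : nat -> formula S) p :
  sat v w (pinst s p) <-> peval (fun n => `[< sat v w (s n) >]) p.
Proof.
elim: p => /= [n|p IH|p IHp q IHq].
- by split=> /asboolP.
- by rewrite IH; split=> /negP.
- by rewrite IHp IHq; split=> /implyP.
Qed.

End Satisfaction.

Definition one_world {S : signature} (M : fo_model S) : structure S :=
  @Structure S unit (inhabits tt) (fun _ => carrier M)
    (fun _ => carrier_inhabited M) (fun P _ => @fo_interp S M P).

Lemma sat_one_world {S : signature} {M : fo_model S} (v : valuation (one_world M))
    (A : formula S) :
  box_free A -> sat v tt A <-> fo_sat (fun x => v x tt) A.
Proof.
elim: A v => //= [B IH|B IHB C IHC|x B IH] v.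
- by move=> /IH ->.
- by case/andP=> bB bC; rewrite IHB ?IHC.
- move=> bB; have E a : sat (@update S (one_world M) v x tt a) tt B <->
      fo_sat (fun y => if y == x then a else v y tt) B.
    rewrite IH //; suff -> : (fun y => @update S (one_world M) v x tt a y tt) =
      (fun y => if y == x then a else v y tt) by [].
    by apply/funext => y; rewrite (@update_at S (one_world M)).
  by split=> H a; apply/E.
Qed.

Lemma universal_FOL {S : signature} {M : structure S} (A : formula S) :
  universal M -> box_free A -> true_in M A -> FOL A.
Proof.
move=> uM bA MA; split=> // N r.
(* With a single world, the assignment [r] is already a valuation. *)
by apply/(sat_one_world (fun x _ => r x : dom (s := one_world N) tt) A bA);
  apply: uM bA MA _ _ _.
Qed.

Theorem theorem1 (S : signature) (A : formula S) :
  FOLbox A -> logically_valid A.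
Proof.
(* Fixing [M] first makes the induction hypothesis truth throughout [M], which is what (RG)
   needs. *)
move=> thA M uM; elim: A / thA => /=.
- by move=> p s tp v w; apply/sat_pinst.
- by move=> A B v w /= AB HA v' w'; apply: AB.
- by move=> A v w /=; apply.
- by move=> A v w /= nA _ _.
- by move=> x y A adm v w /= HA; apply/sat_subst.
- move=> x A B xA v w /= AB HA a; apply: (AB a).
  apply: (proj2 (sat_ext _ v _ _ _)) HA => y yA; rewrite update_at.
  by case: eqP yA xA => // -> ->.
- by [].
- move=> x y A _ adm v w /= /not_implyP[exy /contrapT HA].
  (* Since [x] and [y] agree at [w], giving [x] the value of [y] there changes nothing. *)
  apply/sat_subst => //; apply: (proj2 (sat_ext _ v _ _ _)) HA => z _.
  by rewrite update_at; case: eqP => // ->.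
- by move=> x A v w /= HA a; apply: HA.
- by move=> A bA nA v w /= HA; apply: nA; apply: universal_FOL uM bA HA.
- by move=> A _ HA v w v' w'; apply: HA.
- by move=> A B _ AB _ HA v w; apply: AB; apply: HA.
Qed.
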